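(* There are path-connected compact metrizable spaces which are not $e$-closed.
   Context: ''Space'' means compact metrizable space and ''map'' means continuous function. A space pair is a pair $(Y,Z)$ where $Y$ is a space and $Z\subseteq Y$ is a closed subspace. For spaces $X,Z$, $X^Z$ denotes the set of maps from $Z$ to $X$ with the topology of uniform convergence (equivalently, the compact-open topology). For a space pair $(Y,Z)$, $X^{Z\uparrow Y}\subseteq X^Z$ denotes the set of maps from $Z$ to $X$ which extend to a map from $Y$ to $X$. A space $X$ is $e$-closed if, for every space pair $(Y,Z)$, the set $X^{Z\uparrow Y}$ is closed in $X^Z$. *)

(* Defs.v *)
From mathcomp Require Import all_boot all_order all_algebra.
From mathcomp Require Import all_classical all_reals topology.
Import numFieldTopology.Exports.

Set Implicit Arguments.
Unset Strict Implicit.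
Unset Printing Implicit Defensive.

Local Open Scope classical_set_scope.
Local Open Scope ring_scope.

(* metricType bundles a chosen metric; here the metric is only required to
   exist, via a homeomorphism f (with inverse g) onto a metric space. *)
Definition metrizable (R : realType) (T : topologicalType) : Prop :=
  exists (M : metricType R) (f : T -> M) (g : M -> T),
    [/\ cancel f g, cancel g f, continuous f & continuous g].

Definition compact_metrizable (R : realType) (T : topologicalType) : Prop :=
  compact [set: T] /\ metrizable R T.

Definition path_connected (R : realType) (T : topologicalType) : Prop :=
  forall x y : T, exists gamma : R -> T,
    [/\ {within `[0, 1], continuous gamma}, gamma 0 = x & gamma 1 = y].

(* X^Z: the continuous maps Z -> X, topologized as a subspace of all functions
   Z -> X with the compact-open topology; for Z compact and X metrizable this
   is the topology of uniform convergence. *)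
Definition map_space (Z X : topologicalType) : topologicalType :=
  initial_topology
    (fun f : continuousType Z X => (f : {compact-open, Z -> X})).

(* X^{Z↑Y}; Z : set Y is coerced to the type of its points, which carries the
   topology induced by the inclusion set_val : Z -> Y. *)
Definition extendable (X Y : topologicalType) (Z : set Y) :
    set (map_space Z X) :=
  [set f : continuousType Z X |
    exists g : continuousType Y X, forall z : Z, g (set_val z) = f z].

Definition e_closed (R : realType) (X : topologicalType) : Prop :=
  forall (Y : topologicalType) (Z : set Y),
    compact_metrizable R Y -> closed Z -> closed (@extendable X Y Z).

(* Main.v *)
From HB Require Import structures.
Require Import Defs.
From mathcomp Require Import all_boot all_order all_algebra.
From mathcomp Require Import all_classical all_reals topology.
From mathcomp Require Import normedtype sequences trigo.
From mathcomp Require Import ring lra.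
Import Order.TTheory GRing.Theory Num.Theory numFieldNormedType.Exports.

(** A compact path-connected space X is not e-closed as soon as it is not
locally path-connected at some point x.  Take points x_n tending to x that no
small paths join to x, let Z consist of 0 and all 1/n, and send 1/n to x_n and
0 to x.  This map Z -> X does not extend to [0, 1], whereas it is the uniform
limit of maps with finitely many values, which do extend.

Here X is the planar region below the curve s = |cos (pi / t)|, for
0 <= t <= 1, with the whole segment {0} x [0, 1] above t = 0.  It is
path-connected because every vertical fibre is a segment standing on the base
[0, 1] x {0} ([path_connected_region]).  Then Z is the set of the t in
Y = [0, 1] at which the curve reaches height 1, and the map f : Z -> X sends t
to the crest (t, 1).

- f is a limit of extendable maps: replace t by max (t, 1 / (n + 1)).  The
  resulting map Z -> X converges to f ([shrink_cvg], [cvg_compact_open_comp]),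
  and it extends to Y by following the curve, which is continuous away from
  t = 0 ([follow_continuous]).
- f is not extendable ([crest_map_not_extendable]): an extension g has second
  coordinate 1 at 0, so it stays above the base near 0; but between the
  parameters 1 / (n + 2) and 1 / (n + 1) the first coordinate of g must pass,
  by the intermediate value theorem, through a zero of the curve, where the
  region has only its base point. *)

Local Open Scope classical_set_scope.
Local Open Scope ring_scope.

(** * Subspaces and the compact-open topology *)

Lemma set_val_continuous {T : topologicalType} (A : set T) :
  continuous (@set_val T A).
Proof. exact: initial_continuous. Qed.

Lemma compact_setT_set_type {T : topologicalType} {A : set T} :
  compact A -> compact [set: A].
Proof.
move=> cA F PF _.
have FA : (@set_val T A @ F) A.
  by apply: (@filterS _ F _ setT) => [[x /set_mem]//|]; exact: filterT.
have [p [Ap Fp]] := cA (@set_val T A @ F) (fmap_proper_filter _ PF) FA.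
exists (SigSub (mem_set Ap)); split => // B C FB [_ [[O oO <-] Op sOC]].
have [||_ [[x Bx <-] Ox]] := Fp (set_val @` B) O.
- by apply: (@filterS _ F _ B) => // x Bx; exists x.
- exact: open_nbhs_nbhs.
- by exists x; split => //; exact: sOC.
Qed.

(** The norm distance restricted to [A] induces the balls of the subspace, so
that the identity is the required homeomorphism. *)
Lemma metrizable_set_type {R : realType} {V : normedModType R} (A : set V) :
  metrizable R A.
Proof.
pose d (x y : A) := `|set_val x - set_val y| : R.
have d_ge0 x y : 0 <= d x y by exact: normr_ge0.
have d_eq0 x y : d x y = 0 -> x = y.
  by move/normr0_eq0/eqP; rewrite subr_eq0 => /eqP /val_inj.
have ballE (x : A) e : ball x e = [set y | d x y < e].
  by rewrite -initial_ballE -ball_normE.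
pose mx := PseudoMetric_isMetric.Build R A d_ge0 d_eq0 ballE.
pose M : metricType R := HB.pack (set_type A) (PseudoMetric.on (set_type A)) mx.
by exists M, id, id; split => // x; exact: cvg_id.
Qed.

Lemma compact_metrizable_set_type {R : realType} {V : normedModType R}
    (A : set V) : compact A -> compact_metrizable R A.
Proof.
by move=> cA; split; [exact: compact_setT_set_type|exact: metrizable_set_type].
Qed.

Lemma continuous_pair {T U V : topologicalType} (f : T -> U) (g : T -> V) x :
  {for x, continuous f} -> {for x, continuous g} ->
  {for x, continuous (fun y => (f y, g y))}.
Proof. by move=> cf cg; apply: (cvg_pair cf cg). Qed.

Lemma cvg_set_val {T : topologicalType} {A : set T} {I : Type}
    {F : set_system I} {FF : Filter F} (f : I -> A) (x : A) :
  set_val (f i) @[i --> F] --> set_val x -> f i @[i --> F] --> x.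
Proof.
move=> fx B [_ [[O oO <-] Ox sOB]].
apply: (@filterS _ F _ _ _ (fun i => sOB (f i))).
by apply: fx; exact: open_nbhs_nbhs.
Qed.

(** Joint convergence of [r i z'] to [z] as [z'] tends to [z] and [i] varies
along [F] is local uniformity; near-covering makes it uniform on compact sets,
which is what the compact-open topology tests. *)
Lemma cvg_compact_open_comp {Z X : topologicalType} {I : Type}
    {F : set_system I} {FF : Filter F} (f : Z -> X) (r : I -> Z -> Z) :
  continuous f ->
  (forall z : Z, r p.2 p.1 @[p --> (nbhs z, F)] --> z) ->
  f \o r i @[i --> F] --> (f : {compact-open, Z -> X}).
Proof.
move=> cf rz; apply/compact_open_cvgP => K O cK oO fKO.
have nearK := (compact_near_coveringP K).1 cK I F (fun i z => O (f (r i z))) _.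
have : \forall i \near F, K `<=` (fun z => O (f (r i z))).
  apply: nearK => z Kz.
  have Ofz : nbhs (f z) O.
    by apply: open_nbhs_nbhs; split => //; apply: fKO; exists z.
  exact: (rz z _ (cf z _ Ofz)).
by apply: filterS => i KO _ [z Kz <-]; exact: KO.
Qed.

(** * The region below an oscillating curve *)

Section region.
Context {R : realType}.
Implicit Types (t s : R) (n : nat).

(** Since [0^-1 = 0], the value at 0 is [|cos 0| = 1], the upper limit of the
oscillation: this makes the curve upper semicontinuous, hence the region below
it closed, with no special case at 0. *)
Definition wave t : R := `|cos (pi * t^-1)|.

Lemma wave_ge0 t : 0 <= wave t. Proof. exact: normr_ge0. Qed.

Lemma wave_le1 t : wave t <= 1.
Proof. by rewrite ler_norml cos_geN1 cos_le1. Qed.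

Lemma wave0 : wave 0 = 1.
Proof. by rewrite /wave invr0 mulr0 cos0 normr1. Qed.

Lemma wave_continuous t : t != 0 -> {for t, continuous wave}.
Proof.
move=> t0; apply: (@continuous_comp _ _ _ (fun t => cos (pi * t^-1))
    (@Num.norm _ _)).
  apply: (@continuous_comp _ _ _ (fun t => pi * t^-1) cos).
    by apply: cvgM; [exact: cvg_cst|exact: cvgV].
  exact: continuous_cos.
exact: norm_continuous.
Qed.

Lemma norm_cosDnpi n t : `|cos (t + n%:R * pi)| = `|cos t|.
Proof.
elim: n => [|n IH]; first by rewrite mul0r addr0.
by rewrite -natr1 mulrDl mul1r addrA cosDpi normrN.
Qed.

Lemma wave_harmonic n : wave (harmonic n) = 1.
Proof.
by rewrite /wave /harmonic/= invrK mulrC -[_ * pi]add0r norm_cosDnpi cos0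
  normr1.
Qed.

Lemma wave_eq0 n : wave (n%:R + 2^-1)^-1 = 0.
Proof.
by rewrite /wave invrK mulrDr addrC [pi * n%:R]mulrC norm_cosDnpi cos_pihalf
  normr0.
Qed.

Definition region : set (R * R) :=
  [set p | 0 <= p.1 <= 1 /\ 0 <= p.2 <= wave p.1].

(** Upper semicontinuity of [wave]: it is continuous off 0, and at 0 it takes
its maximal value. *)
Lemma closed_hypograph_wave : closed [set p : R * R | p.2 <= wave p.1].
Proof.
have -> : [set p : R * R | p.2 <= wave p.1] = ~` [set p | wave p.1 < p.2].
  by apply/seteqP; split => p /=; rewrite leNgt => /negP.
apply: open_closedC; rewrite openE => -[t s] /= ts.
have [t0|t0] := eqVneq t 0.
  have s1 : 1 < s by rewrite -wave0 -t0.
  have : \forall p \near (t, s), 1 < p.2.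
    by apply: (@cvgr_gt _ _ (nbhs (t, s)) _ snd s) => //; exact: cvg_snd.
  by apply: filterS => p; apply: le_lt_trans; exact: wave_le1.
have : \forall p \near (t, s), 0 < p.2 - wave p.1.
  apply: (@cvgr_gt _ _ (nbhs (t, s)) _ (fun p => p.2 - wave p.1) (s - wave t));
    last by rewrite subr_gt0.
  apply: cvgB; first exact: cvg_snd.
  apply: (@continuous_comp _ _ _ fst wave (t, s)); first exact: cvg_fst.
  exact: wave_continuous.
by apply: filterS => p; rewrite /= subr_gt0.
Qed.

Lemma compact_region : compact region.
Proof.
have -> : region = (`[0, 1] `*` `[0, 1]) `&` [set p | p.2 <= wave p.1].
  apply/seteqP; split => [[t s]|[t s]] /=; rewrite !in_itv/=.
    move=> [? /andP[s0 sw]]; rewrite s0 sw; split => //; split => //=.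
    exact: (le_trans sw (wave_le1 _)).
  by move=> [[? /andP[? _]] ?]; split => //; apply/andP.
apply: compact_closedI; last exact: closed_hypograph_wave.
by apply: compact_setX; exact: segment_compact.
Qed.

Definition clamp (a : R) : R := Num.max 0 (Num.min 1 a).

Lemma clamp_itv a : 0 <= clamp a <= 1.
Proof. by rewrite /clamp le_max lexx ge_max ler01 ge_min lexx. Qed.

Lemma clamp_id a : 0 <= a <= 1 -> clamp a = a.
Proof. by move=> /andP[a0 a1]; rewrite /clamp (min_idPr a1) (max_idPr a0). Qed.

Lemma clamp_le0 a : a <= 0 -> clamp a = 0.
Proof. by move=> a0; apply/max_idPl; rewrite ge_min a0 orbT. Qed.

Lemma clamp_ge1 a : 1 <= a -> clamp a = 1.
Proof. by move=> a1; rewrite /clamp (min_idPl a1) (max_idPr ler01). Qed.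

Lemma clamp_continuous : continuous clamp.
Proof.
move=> a; rewrite -/({for a, continuous clamp}).
have c0 c : {for a, continuous (fun=> c : R)} by exact: cvg_cst.
have cmin : {for a, continuous (fun b : R => Num.min 1 b)}.
  by apply: continuous_min; [exact: c0|exact: cvg_id].
exact: (continuous_max (c0 0) cmin).
Qed.

(** An explicit path from [(t, s)] to [(t', s')]: go down the fibre over [t]
during the first third of the time, along the base during the second, and up the
fibre over [t'] during the third. *)
Lemma path_connected_region : path_connected R region.
Proof.
move=> x y; case: x y => -[t s] xP [[t' s'] yP].
have [/= tP sP] := set_mem xP; have [/= t'P s'P] := set_mem yP.
pose a r := t + (t' - t) * clamp (3 * r - 1).
pose b r := Num.max 0 (Num.max (s * (1 - 3 * r)) (s' * (3 * r - 2))).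
have aP r : 0 <= a r <= 1.
  by have := clamp_itv (3 * r - 1); rewrite /a; move: (clamp _) => c cP; nra.
have a_l r : r <= 1 / 3 -> a r = t.
  by move=> rP; rewrite /a clamp_le0 ?mulr0 ?addr0//; lra.
have a_r r : 2 / 3 <= r -> a r = t'.
  by move=> rP; rewrite /a clamp_ge1 ?mulr1 ?addrNK 1?addrC ?subrK//; lra.
have bP r c : 0 <= c -> s * (1 - 3 * r) <= c -> s' * (3 * r - 2) <= c ->
    0 <= b r <= c.
  by rewrite /b le_max lexx !ge_max => -> -> ->.
(* Membership is needed at every real time, hence the clamped time. *)
have abP r : region (a (clamp r), b (clamp r)).
  have := clamp_itv r; move: (clamp r) => {}r rP; split => //=.
  apply: bP; first exact: wave_ge0.
  - have [r1|r1] := leP r (1 / 3); first by rewrite a_l//; nra.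
    by apply: le_trans (wave_ge0 _); nra.
  - have [r2|r2] := leP (2 / 3) r; first by rewrite a_r//; nra.
    by apply: le_trans (wave_ge0 _); nra.
exists (fun r => SigSub (mem_set (abP r))); split.
- apply: continuous_subspaceT; apply: continuous_comp_initial => r.
  apply: (@continuous_comp _ _ _ clamp (fun r => (a r, b r))).
    exact: clamp_continuous.
  have lin c k : {for clamp r, continuous (fun r : R => k * r - c)}.
    apply: cvgB; last exact: cvg_cst.
    by apply: cvgM; [exact: cvg_cst|exact: cvg_id].
  apply: continuous_pair.
    apply: cvgD; [exact: cvg_cst|apply: cvgM; [exact: cvg_cst|]].
    apply: (@continuous_comp _ _ _ (fun r : R => 3 * r - 1) clamp).
      exact: lin.
    exact: clamp_continuous.
  have c0 : {for clamp r, continuous (fun=> 0 : R)} by exact: cvg_cst.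
  have c1 : {for clamp r, continuous (fun r : R => s * (1 - 3 * r))}.
    by apply: cvgM; [exact: cvg_cst|apply: cvgB; [exact: cvg_cst|
      apply: cvgM; [exact: cvg_cst|exact: cvg_id]]].
  have c2 : {for clamp r, continuous (fun r : R => s' * (3 * r - 2))}.
    by apply: cvgM; [exact: cvg_cst|exact: lin].
  exact: (continuous_max c0 (continuous_max c1 c2)).
- apply: val_inj => /=; rewrite clamp_id ?lexx ?ler01// a_l; last lra.
  congr pair; rewrite /b.
  rewrite (_ : s * _ = s); last ring.
  rewrite (@max_l _ _ s) ?max_r//; lra.
- apply: val_inj => /=; rewrite clamp_id ?lexx ?ler01// a_r; last lra.
  congr pair; rewrite /b.
  rewrite (_ : s' * _ = s'); last ring.
  rewrite (@max_r _ _ _ s') ?max_r//; lra.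
Qed.

(** * A sequence of extendable maps *)

Definition segment : set R := `[0, 1].

Lemma harmonic_itv n : 0 <= (harmonic n : R) <= 1.
Proof.
by rewrite harmonic_ge0 /harmonic/= invr_le1 ?unitf_gt0 ?ltr0n// ler1n.
Qed.

Definition crests : set segment := [set y | wave (set_val y) = 1].

(** The maximum of an upper semicontinuous function is attained on a closed
set. *)
Lemma closed_crests : closed crests.
Proof.
have -> : crests = (fun y : segment => (set_val y, 1 : R)) @^-1`
    [set p : R * R | p.2 <= wave p.1].
  apply/seteqP; split => y /=; first by rewrite /crests/= => ->.
  by move=> w1; apply/eqP; rewrite eq_le wave_le1 w1.
apply: closed_comp closed_hypograph_wave => y _.
apply: (@continuous_pair _ _ _ set_val (fun=> 1 : R)).
  exact: set_val_continuous.
exact: cst_continuous.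
Qed.

(** Pushing parameters up to [1 / (n + 1)], where the curve has a crest, maps
crests to crests and avoids the parameter 0. *)
Definition push n t : R := Num.max t (harmonic n).

Lemma push_continuous n : continuous (push n).
Proof.
move=> t; rewrite -/({for t, continuous (push n)}).
by apply: continuous_max; [exact: cvg_id|exact: cvg_cst].
Qed.

Lemma segmentP (y : segment) : 0 <= set_val y <= 1.
Proof. by have := set_valP y; rewrite /segment/= in_itv. Qed.

Lemma crestsP (z : crests) : wave (set_val (set_val z)) = 1.
Proof. exact: (set_valP z). Qed.

Lemma push_itv n (y : segment) : 0 <= push n (set_val y) <= 1.
Proof.
have /andP[y0 y1] := segmentP y.
by have /andP[h0 h1] := harmonic_itv n; rewrite le_max y0 ge_max y1.
Qed.

Lemma wave_push n (z : crests) : wave (push n (set_val (set_val z))) = 1.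
Proof.
rewrite /push; case: leP => _; [exact: wave_harmonic|exact: crestsP].
Qed.

Lemma region_crest (z : crests) : region (set_val (set_val z), 1).
Proof.
split => /=; first exact: segmentP.
by rewrite crestsP ler01 lexx.
Qed.

Definition crest_map (z : crests) : region := SigSub (mem_set (region_crest z)).

Lemma crest_map_continuous : continuous crest_map.
Proof.
apply: continuous_comp_initial => z.
apply: (@continuous_pair _ _ _ (fun z : crests => set_val (set_val z))
    (fun=> 1 : R)).
  by apply: continuous_comp; exact: set_val_continuous.
exact: cst_continuous.
Qed.

Lemma region_follow n (y : segment) :
  region (push n (set_val y), wave (push n (set_val y))).
Proof. by split; rewrite /= ?push_itv// wave_ge0 lexx. Qed.

Definition follow n (y : segment) : region :=
  SigSub (mem_set (region_follow n y)).

(** The point of the curve moves continuously because [push n] keeps the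
parameter at least [harmonic n], away from the oscillation at 0. *)
Lemma follow_continuous n : continuous (follow n).
Proof.
apply: continuous_comp_initial => y.
have cp : {for y, continuous (fun y : segment => push n (set_val y))}.
  apply: (@continuous_comp _ _ _ set_val (push n)).
    exact: set_val_continuous.
  exact: push_continuous.
apply: (@continuous_pair _ _ _ _ (wave \o _) _ cp).
apply: continuous_comp cp _; apply: wave_continuous.
by rewrite gt_eqF// lt_max harmonic_gt0 orbT.
Qed.

Lemma crests_push n (z : crests) :
  crests (SigSub (mem_set (push_itv n (set_val z) : segment _))).
Proof. exact: wave_push. Qed.

Definition shrink n (z : crests) : crests := SigSub (mem_set (crests_push n z)).

Lemma shrink_cvg (z : crests) : shrink p.2 p.1 @[p --> (nbhs z, \oo)] --> z.
Proof.
apply: cvg_set_val; apply: cvg_set_val => /=.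
set t := set_val (set_val z).
have -> : t = Num.max t 0.
  by have /andP[t0 _] := segmentP (set_val z); rewrite max_l.
have maxc : {for (t, 0 : R), continuous (fun q : R * R => Num.max q.1 q.2)}.
  by apply: continuous_max; [exact: cvg_fst|exact: cvg_snd].
have cvgt : set_val (set_val p.1) @[p --> (nbhs z, \oo)] --> t.
  apply: (cvg_comp fst (fun z : crests => set_val (set_val z))).
    exact: cvg_fst.
  by apply: continuous_comp; exact: set_val_continuous.
have cvgh : (harmonic p.2 : R) @[p --> (nbhs z, \oo)] --> 0.
  by apply: (cvg_comp snd harmonic); [exact: cvg_snd|exact: cvg_harmonic].
exact: (cvg_comp _ _ (cvg_pair cvgt cvgh) maxc).
Qed.

(** A crest pushed up is again a crest, so the curve has height 1 there. *)
Lemma follow_shrink n z : follow n (set_val z) = crest_map (shrink n z).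
Proof. by apply: val_inj => /=; rewrite wave_push. Qed.

(** * The crest map does not extend *)

(** Near 0 an extension stays off the base, yet to get from one crest to the
next it has to cross a zero of [wave]. *)
Lemma crest_map_not_extendable (g : continuousType segment region) :
  ~ (forall z, g (set_val z) = crest_map z).
Proof.
move=> gE.
(* Precomposing with [clamp] gives functions on the line, to which the
   intermediate value theorem applies. *)
have clampP t : segment (clamp t) by rewrite /segment/= in_itv/= clamp_itv.
pose Y t : segment := SigSub (mem_set (clampP t)).
pose G t : region := g (Y t).
have Yc : continuous Y by move=> t; apply: cvg_set_val; exact: clamp_continuous.
have Gc : continuous G.
  by move=> t; exact: (continuous_comp (Yc t) (@cts_fun _ _ g (Y t))).
have G1 : continuous (fun t => (set_val (G t)).1).
  move=> t; apply: (@continuous_comp _ _ _ G (fun x => (set_val x).1)).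
    exact: Gc.
  apply: (@continuous_comp _ _ _ set_val fst); first exact: set_val_continuous.
  exact: cvg_fst.
have G2 : continuous (fun t => (set_val (G t)).2).
  move=> t; apply: (@continuous_comp _ _ _ G (fun x => (set_val x).2)).
    exact: Gc.
  apply: (@continuous_comp _ _ _ set_val snd); first exact: set_val_continuous.
  exact: cvg_snd.
have GE t : 0 <= t <= 1 -> wave t = 1 -> set_val (G t) = (t, 1).
  move=> tP wt.
  have Yt : set_val (Y t) = t by exact: clamp_id.
  have yP : crests (Y t) by rewrite /crests/= Yt.
  by rewrite /G (gE (SigSub (mem_set yP))); congr pair.
have : \forall t \near 0, 0 < (set_val (G t)).2.
  have G20 : (set_val (G 0)).2 = 1 by rewrite GE ?wave0 ?lexx ?ler01.
  by apply: (cvgr_gt _ (G2 0)); rewrite G20.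
move=> /nbhs_ballP[e /= e0 eG].
have [n _ /(_ n (leqnn n)) /= ne] : \forall n \near \oo, (harmonic n : R) < e.
  exact: (cvgr_lt _ cvg_harmonic).
(* A zero of [wave] strictly between two consecutive crests. *)
pose c : R := (n.+1%:R + 2^-1)^-1.
have n0 : 0 < n.+1%:R :> R by rewrite ltr0n.
have hc : (harmonic n.+1 : R) <= c <= harmonic n.
  rewrite /c /harmonic/= !lef_pV2 ?posrE ?ltr0n//; last 2 first.
  - lra.
  - lra.
  by rewrite -[n.+2%:R]natr1; lra.
have [/=||t] :=
  @IVT R _ (harmonic n.+1) (harmonic n) c _ (continuous_subspaceT G1).
- by case/andP: hc; exact: le_trans.
- rewrite !GE ?harmonic_itv ?wave_harmonic//= ge_min le_max.
  by case/andP: hc => -> ->; rewrite orbT.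
rewrite in_itv/= => /andP[ht th] Gt.
have := set_valP (G t) => -[_]; rewrite Gt wave_eq0 => /andP[_].
rewrite leNgt => /negP; apply; apply: eG.
rewrite /ball/= sub0r normrN ger0_norm; first exact: le_lt_trans ne.
exact: le_trans (harmonic_ge0 _) ht.
Qed.

Lemma extendable_not_closed :
  ~ closed (@extendable region segment crests).
Proof.
pose f : continuousType crests region := mkcts crest_map_continuous.
move=> /(_ f) [B [_ [[O oO <-] Of sOB]]|g];
  last exact: crest_map_not_extendable.
have fc : (f \o shrink n) @[n --> \oo] -->
    (f : {compact-open, crests -> region}).
  by apply: cvg_compact_open_comp;
    [exact: crest_map_continuous|exact: shrink_cvg].
have [n _ /(_ n (leqnn n)) On] := fc _ (open_nbhs_nbhs (conj oO Of)).
have fE : f \o shrink n = follow n \o set_val.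
  by apply/funext => z; rewrite /= follow_shrink.
have fnc : continuous (f \o shrink n : crests -> region).
  rewrite fE => z.
  exact: (continuous_comp (@set_val_continuous _ _ z) (@follow_continuous n _)).
pose fn : continuousType crests region := mkcts fnc.
pose gn : continuousType segment region := mkcts (@follow_continuous n).
exists fn; split; last exact: (sOB fn On).
by exists gn => z; exact: follow_shrink.
Qed.

End region.

Theorem mainTheorem9 (R : realType) :
  exists X : topologicalType,
    [/\ compact_metrizable R X, path_connected R X & ~ e_closed R X].
Proof.
exists (region : set (R * R)); split.
- by apply: compact_metrizable_set_type; exact: compact_region.
- exact: path_connected_region.
have segmentM : compact_metrizable R (segment : set R).
  by apply: compact_metrizable_set_type; exact: segment_compact.
by move=> /(_ _ _ segmentM closed_crests); exact: extendable_not_closed.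
Qed.
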